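(* Let the multi-time wave function $\Psi$ on $\mathscr{S}_{xy}$ satisfy the Dirac law, the Maxwell law and, in a chosen Lorentz frame, the Coulomb gauge condition $\sum_{\mu_k=1}^3\partial_{y_k}^{\mu_k}\Psi^{(m,n)}_{\mu_k}=0$ for all $m,n$ and $1\le k\le n$. Let $F^{(m,n)}=d_1\cdots d_n\Psi^{(m,n)}$ and let $\underline F^{(m,n)}$ be its restriction to configurations that are simultaneous in the chosen frame, $x_1^0=\dots=x_m^0=y_1^0=\dots=y_n^0=t$. Then $$i\partial_t\underline F^{(m,n)}=\sum_{j=1}^mH^{\mathrm{free}}_{x_j}\underline F^{(m,n)}+\sum_{k=1}^nH^{\mathrm{free}}_{y_k}\underline F^{(m,n)}+\sum_{j=1}^m e_x\sqrt{n+1}\,\Bigl[(-\Delta_{y_{n+1}})^{-1}\boldsymbol\nabla_{y_{n+1}}\cdot\boldsymbol E_{n+1}+\boldsymbol\alpha_j\cdot(-\Delta_{y_{n+1}})^{-1}\boldsymbol\nabla_{y_{n+1}}\times\boldsymbol B_{n+1}\Bigr]_{y_{n+1}=x_j}+\frac{e_x}{\sqrt n}\sum_{j=1}^m\sum_{k=1}^n\delta^3(\boldsymbol y_k-\boldsymbol x_j)\begin{pmatrix}\boldsymbol\alpha_j\\\boldsymbol0\end{pmatrix}_{\!k}\underline F^{(m,n-1)}_{\widehat{\mu_k\nu_k}}(\widehat{y_k}),$$ where $(\boldsymbol E_{n+1},\boldsymbol B_{n+1})$ are the electric and magnetic components of $\underline F^{(m,n+1)}$ with respect to the index pair $\mu_{n+1}\nu_{n+1}$,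 and the column $(\cdot)_k$ lists the electric and magnetic components with respect to the index pair $\mu_k\nu_k$. In addition, for every $1\le k\le n$, the electric and magnetic components $\boldsymbol E_k,\boldsymbol B_k$ of $\underline F^{(m,n)}$ with respect to $\mu_k\nu_k$ satisfy the constraint conditions $$\boldsymbol\nabla_{y_k}\cdot\boldsymbol E_k=\frac{e_x}{\sqrt n}\sum_{j=1}^m\delta^3(\boldsymbol y_k-\boldsymbol x_j)\,\underline F^{(m,n-1)}_{\widehat{\mu_k\nu_k}}(\widehat{y_k}),\qquad\boldsymbol\nabla_{y_k}\cdot\boldsymbol B_k=0 .$$
   Context: Conventions. $\mathbb{M}^4$ is Minkowski space-time with metric $\mathrm{diag}(1,-1,-1,-1)$; $c=\hbar=\varepsilon_0=\mu_0=1$; summation convention; $\gamma^\mu$ are the Dirac matrices, $\beta=\gamma^0$, $\boldsymbol\alpha=(\gamma^0\gamma^1,\gamma^0\gamma^2,\gamma^0\gamma^3)$; a subscript $j$ on such a matrix means it acts on the spin index $s_j$. $e_x,m_x$ are real constants (charge and mass of the electron). $S_{[\mu\nu]}=\frac12(S_{\mu\nu}-S_{\nu\mu})$. A hat over a variable or index means it is omitted. $\boldsymbol\nabla=(\partial_1,\partial_2,\partial_3)$, $\Delta=\partial_1^2+\partial_2^2+\partial_3^2$. Wave function. A configuration $(x_1...x_m,y_1...y_n)$ of space-time points is spacelike if any two of the points are spacelike separated or equal; $\mathscr{S}_{xy}$ is the set of all spacelike configurations with any $m,n\ge0$. $\Psi$ is a function on $\mathscr{S}_{xy}$ whose restriction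 $\Psi^{(m,n)}$ to configurations with $m$ electrons $x_j$ and $n$ photons $y_k$ has complex components $\Psi^{(m,n)}_{s_1...s_m,\mu_1...\mu_n}$, $s_j\in\{1,2,3,4\}$, $\mu_k\in\{0,1,2,3\}$, antisymmetric under permutations of the $x_j$ together with the $s_j$, symmetric under permutations of the $y_k$ together with the $\mu_k$. $\delta^3_\mu$ is the Lorentz-invariant vector-valued distribution on $\{x: x=0\text{ or }x\text{ spacelike}\}$ with $\int_\Sigma V(d^3x)\,n^\mu\,\delta^3_\mu\, f=f(0)$ for every smooth spacelike Cauchy surface $\Sigma$ through $0$ (with Riemannian volume $V$ and future unit normal $n^\mu$) and every smooth $f$; on $\{x^0=0\}$ it is $(\delta^3(\boldsymbol x),0,0,0)$. Dirac law: $(i\gamma^\mu_j\partial_{x_j,\mu}-m_x)\Psi^{(m,n)}(x_1...x_m,y_1...y_n)=e_x\sqrt{n+1}\,\gamma^\rho_j\,\Psi^{(m,n+1)}_{\mu_{n+1}=\rho}(x_1...x_m,y_1...y_n,x_j)$ for all $m,n$, $1\le j\le m$. Maxwell law: $2\partial^\mu_{y_k}\partial_{y_k,[\mu}\Psi^{(m,n)}_{\mu_k=\nu]}=\frac{e_x}{\sqrt n}\sum_{j=1}^m\delta^3_\mu(y_k-x_j)\gamma^\mu_j\gamma_{j\nu}\Psi^{(m,n-1)}_{\widehat{\mu_k}}(\widehat{y_k})$ for all $m,n$, $1\le k\le n$. Field tensor representation. $d$ is the exterior derivative, $(dA)_{\mu\nu}=\partial_\mu A_\nu-\partial_\nu A_\mu$,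 and $d_k$ is $d$ applied to the variable $y_k$ and the index $\mu_k$ (replacing $\mu_k$ by the pair $\mu_k\nu_k$). An antisymmetric $F_{\mu\nu}$ is rewritten as the pair $(\boldsymbol E,\boldsymbol B)$ with $E^i=F_{0i}$ and $B^i=-\frac12\sum_{j,k=1}^3\varepsilon^{ijk}F_{jk}$, so that for $F=dA$ with $A_\mu=(A_0,-\boldsymbol A)$ one has $\boldsymbol E=-\boldsymbol\nabla A_0-\partial_0\boldsymbol A$ and $\boldsymbol B=\boldsymbol\nabla\times\boldsymbol A$. Free Hamiltonians. $H^{\mathrm{free}}_{x_j}=-i\boldsymbol\alpha_j\cdot\boldsymbol\nabla_{x_j}+m_x\beta_j$; $H^{\mathrm{free}}_{y_k}$ acts on $y_k$ and $\mu_k\nu_k$ as $(\boldsymbol E,\boldsymbol B)\mapsto(i\boldsymbol\nabla\times\boldsymbol B,\,-i\boldsymbol\nabla\times\boldsymbol E)$. Formal setting. The equations are understood formally (they are ultraviolet divergent); it is taken for granted that at fixed time the vector potential and field components are square-integrable functions of position in each photon variable, so that in the Coulomb gauge the potential is recovered from the fields by $A_0=(-\Delta)^{-1}\boldsymbol\nabla\cdot\boldsymbol E$, $\boldsymbol A=(-\Delta)^{-1}\boldsymbol\nabla\times\boldsymbol B$.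
   Formalization: The formal statement corrects the evolution equation: the term α_j·(−Δ)^{-1}∇×B carries a minus sign instead of plus, and the emission term with δ³(y_k−x_j)(α_j;0) has coefficient −i e_x/√n instead of e_x/√n, as the Dirac and Maxwell laws and stated conventions require. *)

(* Defs.v *)
From HB Require Import structures.
From mathcomp Require Import all_boot all_order all_fingroup all_algebra.
From mathcomp Require Import all_classical all_reals all_analysis.
From mathcomp Require Import complex.
Set Implicit Arguments.
Unset Strict Implicit.
Unset Printing Implicit Defensive.
Import Order.TTheory GRing.Theory Num.Theory.
Import numFieldNormedType.Exports.
Local Open Scope classical_set_scope.
Local Open Scope ring_scope.
Local Open Scope complex_scope.

(** * Index bookkeeping *)

Definition upd (n : nat) (A : Type) (c : {ffun 'I_n -> A}) (k : 'I_n) (a : A)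
    : {ffun 'I_n -> A} := [ffun l => if l == k then a else c l].

(* The hat: the entry in slot [k] is omitted. *)
Definition omit (n : nat) (A : Type) (k : 'I_n) (c : {ffun 'I_n -> A})
    : {ffun 'I_n.-1 -> A} := [ffun l => c (lift k l)].

Definition insert (n : nat) (A : Type) (k : 'I_n) (c : {ffun 'I_n.-1 -> A})
    (a : A) : {ffun 'I_n -> A} :=
  [ffun l => if unlift k l is Some l' then c l' else a].

Definition insert_row (T : Type) (n d : nat) (k : 'I_n) (y : 'M[T]_(n.-1, d))
    (z : 'rV[T]_d) : 'M[T]_(n, d) :=
  \matrix_(l, i) if unlift k l is Some l' then y l' i else z ord0 i.

(* Space-time indices are 'I_4 with time index 0; the spatial direction
   i : 'I_3 is the space-time index i + 1.  Spin indices are 'I_4 too. *)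
Definition tm : 'I_4 := ord0.
Definition sp (i : 'I_3) : 'I_4 := lift ord0 i.

Section Analysis.
Variable R : realType.
Local Notation C := (complex R).

(** * Smooth functions and integrals *)

Definition ddir (V : normedModType R) (v : V) (f : V -> C) (a : V) : C :=
  Complex (derive1 (fun h : R => complex.Re (f (a + h *: v))) 0)
          (derive1 (fun h : R => complex.Im (f (a + h *: v))) 0).

(* All iterated directional derivatives exist and are continuous. *)
Definition smooth (V : normedModType R) (f : V -> C) : Prop :=
  exists2 P : set (V -> C), P f &
    forall g, P g ->
      [/\ continuous (fun a => complex.Re (g a)),
          continuous (fun a => complex.Im (g a)),
          forall a v, derivable (fun a => complex.Re (g a)) a v,
          forall a v, derivable (fun a => complex.Im (g a)) a v &
          forall v, P (ddir v g)].

Definition test_function (f : 'rV[R]_3 -> C) : Prop :=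
  smooth f /\ compact (closure [set z | f z != 0]).

Definition leb3 :=
  ((@lebesgue_measure R \x @lebesgue_measure R) \x @lebesgue_measure R)%E.

Definition vec3 (z : R * R * R) : 'rV[R]_3 :=
  \row_i [:: z.1.1; z.1.2; z.2]`_i.

Definition int3 (f : 'rV[R]_3 -> C) : C :=
  Complex (Rintegral leb3 setT (fun z => complex.Re (f (vec3 z))))
          (Rintegral leb3 setT (fun z => complex.Im (f (vec3 z)))).

Definition square_integrable3 (f : 'rV[R]_3 -> C) : Prop :=
  (\int[leb3]_z (complex.Re (f (vec3 z)) ^+ 2 +
                 complex.Im (f (vec3 z)) ^+ 2)%:E < +oo)%E.

(** * Space-time configurations *)

Definition interval2 (p q : 'rV[R]_4) : R :=
  (p ord0 tm - q ord0 tm) ^+ 2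
  - \sum_(i < 3) (p ord0 (sp i) - q ord0 (sp i)) ^+ 2.

Definition spacelike_or_equal (p q : 'rV[R]_4) : Prop :=
  interval2 p q < 0 \/ p = q.

(* m electrons and n photons, one row per particle. *)
Definition conf (m n : nat) : normedModType R :=
  ('M[R]_(m, 4) * 'M[R]_(n, 4))%type.

Definition spacelike (m n : nat) (c : conf m n) : Prop :=
  [/\ forall i j, spacelike_or_equal (row i c.1) (row j c.1),
      forall i k, spacelike_or_equal (row i c.1) (row k c.2) &
      forall k l, spacelike_or_equal (row k c.2) (row l c.2)].

(* Simultaneous configurations: common time, electron and photon positions. *)
Definition tconf (m n : nat) : normedModType R :=
  (R^o * 'M[R]_(m, 3) * 'M[R]_(n, 3))%type.

Definition at_time (m : nat) (t : R) (x : 'M[R]_(m, 3)) : 'M[R]_(m, 4) :=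
  \matrix_(j, mu) if unlift tm mu is Some i then x j i else t.

Definition simult (m n : nat) (c : tconf m n) : conf m n :=
  (at_time c.1.1 c.1.2, at_time c.1.1 c.2).

End Analysis.

(** * Formal calculus

   The multi-time equations are ultraviolet divergent: the source term of the
   Maxwell law makes Psi^(m,n+1) singular at y_{n+1} = x_j, which is where the
   Dirac law evaluates it.  They are therefore read in a calculus of
   generalized functions in which this evaluation is postulated.  A calculus
   consists of
   - [gf m n], generalized functions on the spacelike configurations, and
     [tgf m n], generalized functions of (t, x, y) for simultaneous ones; both
     contain the smooth functions;
   - the operations that occur in the equations, with the values they have on
     smooth functions, and with the linear rules (commuting derivatives, chain
     rule, translation invariance of delta) that hold for these operations
     whenever they are defined.
   No products of generalized functions are assumed. *)

Record operations (R : realType) := Operations {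
  gf : nat -> nat -> lmodType R[i];
  gfun : forall m n, (conf R m n -> R[i]) -> gf m n;
  (* derivative in coordinate mu of x_j, resp. of y_k *)
  gdx : forall m n, 'I_m -> 'I_4 -> {linear gf m n -> gf m n};
  gdy : forall m n, 'I_n -> 'I_4 -> {linear gf m n -> gf m n};
  (* f(x_sigma(1),...,x_sigma(m), y), resp. the same for the photons *)
  gpx : forall m n, {perm 'I_m} -> {linear gf m n -> gf m n};
  gpy : forall m n, {perm 'I_n} -> {linear gf m n -> gf m n};
  (* [gat j f] is f(x, y, y_{n+1} = x_j) *)
  gat : forall m n, 'I_m -> {linear gf m n.+1 -> gf m n};
  (* [gdelta k j mu f] is delta^3_mu(y_k - x_j) f(x, y without y_k) *)
  gdelta : forall m n, 'I_n -> 'I_m -> 'I_4 -> {linear gf m n.-1 -> gf m n};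

  tgf : nat -> nat -> lmodType R[i];
  tfun : forall m n, (tconf R m n -> R[i]) -> tgf m n;
  tdt : forall m n, {linear tgf m n -> tgf m n};
  tdx : forall m n, 'I_m -> 'I_3 -> {linear tgf m n -> tgf m n};
  tdy : forall m n, 'I_n -> 'I_3 -> {linear tgf m n -> tgf m n};
  tat : forall m n, 'I_m -> {linear tgf m n.+1 -> tgf m n};
  (* [tdelta k j f] is delta^3(y_k - x_j) f(t, x, y without y_k) *)
  tdelta : forall m n, 'I_n -> 'I_m -> {linear tgf m n.-1 -> tgf m n};
  (* multiplication by phi(x_j), for smooth phi *)
  tmulx : forall m n, 'I_m -> ('rV[R]_3 -> R[i]) -> {linear tgf m n -> tgf m n};
  (* integration against phi(y_k) d^3y_k, for a test function phi *)
  tsmear : forall m n, 'I_n -> ('rV[R]_3 -> R[i]) ->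
    {linear tgf m n -> tgf m n.-1};
  (* being a square-integrable function of the position y_k *)
  tL2 : forall m n, 'I_n -> set (tgf m n);
  (* (-Delta_{y_k})^-1 *)
  tinvlap : forall m n, 'I_n -> tgf m n -> tgf m n;

  (* restriction to simultaneous configurations *)
  restr : forall m n, {linear gf m n -> tgf m n}
}.

Arguments gfun {R} o {m n}.
Arguments gdx {R o m n}.
Arguments gdy {R o m n}.
Arguments gpx {R o m n}.
Arguments gpy {R o m n}.
Arguments gat {R o m n}.
Arguments gdelta {R o m n}.
Arguments tfun {R} o {m n}.
Arguments tdt {R o m n}.
Arguments tdx {R o m n}.
Arguments tdy {R o m n}.
Arguments tat {R o m n}.
Arguments tdelta {R o m n}.
Arguments tmulx {R o m n}.
Arguments tsmear {R o m n}.
Arguments tL2 {R o m n}.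
Arguments tinvlap {R o m n}.
Arguments restr {R o m n}.

Record calculus (R : realType) := Calculus {
  ops :> operations R;

  (** Smooth functions among the generalized functions *)
  gfun_eq : forall m n (f g : conf R m n -> R[i]), smooth f -> smooth g ->
    (gfun ops f = gfun ops g <-> forall c, spacelike c -> f c = g c);
  gfun_linear : forall m n (a : R[i]) (f g : conf R m n -> R[i]),
    smooth f -> smooth g ->
    gfun ops (fun c => a * f c + g c) = a *: gfun ops f + gfun ops g;
  gdx_fun : forall m n j mu (f : conf R m n -> R[i]), smooth f ->
    gdx j mu (gfun ops f) = gfun ops (ddir ((delta_mx j mu, 0) : conf R m n) f);
  gdy_fun : forall m n k mu (f : conf R m n -> R[i]), smooth f ->
    gdy k mu (gfun ops f) = gfun ops (ddir ((0, delta_mx k mu) : conf R m n) f);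
  gpx_fun : forall m n (s : {perm 'I_m}) (f : conf R m n -> R[i]), smooth f ->
    gpx s (gfun ops f) = gfun ops (fun c : conf R m n => f (row_perm s c.1, c.2));
  gpy_fun : forall m n (s : {perm 'I_n}) (f : conf R m n -> R[i]), smooth f ->
    gpy s (gfun ops f) = gfun ops (fun c : conf R m n => f (c.1, row_perm s c.2));
  gat_fun : forall m n (j : 'I_m) (f : conf R m n.+1 -> R[i]), smooth f ->
    gat j (gfun ops f) = gfun ops (fun c : conf R m n =>
      f (c.1, insert_row (n := n.+1) ord_max c.2 (row j c.1)));
  tfun_inj : forall m n (f g : tconf R m n -> R[i]), smooth f -> smooth g ->
    tfun ops f = tfun ops g -> f =1 g;
  tfun_linear : forall m n (a : R[i]) (f g : tconf R m n -> R[i]),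
    smooth f -> smooth g ->
    tfun ops (fun c => a * f c + g c) = a *: tfun ops f + tfun ops g;
  tdt_fun : forall m n (f : tconf R m n -> R[i]), smooth f ->
    tdt (tfun ops f) = tfun ops (ddir ((1, 0, 0) : tconf R m n) f);
  tdx_fun : forall m n j i (f : tconf R m n -> R[i]), smooth f ->
    tdx j i (tfun ops f) = tfun ops (ddir ((0, delta_mx j i, 0) : tconf R m n) f);
  tdy_fun : forall m n k i (f : tconf R m n -> R[i]), smooth f ->
    tdy k i (tfun ops f) = tfun ops (ddir ((0, 0, delta_mx k i) : tconf R m n) f);
  tat_fun : forall m n (j : 'I_m) (f : tconf R m n.+1 -> R[i]), smooth f ->
    tat j (tfun ops f) = tfun ops (fun c : tconf R m n =>
      f (c.1, insert_row (n := n.+1) ord_max c.2 (row j c.1.2)));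
  tmulx_fun : forall m n j phi (f : tconf R m n -> R[i]), smooth phi -> smooth f ->
    tmulx j phi (tfun ops f) =
    tfun ops (fun c : tconf R m n => phi (row j c.1.2) * f c);
  tsmear_fun : forall m n (k : 'I_n) phi (f : tconf R m n -> R[i]),
    test_function phi -> smooth f ->
    tsmear k phi (tfun ops f) = tfun ops (fun c : tconf R m n.-1 =>
      int3 (fun z => phi z * f (c.1, insert_row k c.2 z)));
  tL2_fun : forall m n (k : 'I_n) (f : tconf R m n -> R[i]), smooth f ->
    (forall c : tconf R m n.-1,
      square_integrable3 (fun z => f (c.1, insert_row k c.2 z))) ->
    tL2 k (tfun ops f);
  restr_fun : forall m n (f : conf R m n -> R[i]), smooth f ->
    restr (gfun ops f) = tfun ops (fun c : tconf R m n => f (simult c));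

  (** Derivatives commute *)
  gdxC : forall m n j mu j' mu' (f : gf ops m n),
    gdx j mu (gdx j' mu' f) = gdx j' mu' (gdx j mu f);
  gdxyC : forall m n j mu k nu (f : gf ops m n),
    gdx j mu (gdy k nu f) = gdy k nu (gdx j mu f);
  gdyC : forall m n k mu k' mu' (f : gf ops m n),
    gdy k mu (gdy k' mu' f) = gdy k' mu' (gdy k mu f);

  (** Permutations *)
  gdx_px : forall m n s j mu (f : gf ops m n),
    gdx j mu (gpx s f) = gpx s (gdx (s^-1%g j) mu f);
  gdy_px : forall m n s k mu (f : gf ops m n),
    gdy k mu (gpx s f) = gpx s (gdy k mu f);
  gdx_py : forall m n s j mu (f : gf ops m n),
    gdx j mu (gpy s f) = gpy s (gdx j mu f);
  gdy_py : forall m n s k mu (f : gf ops m n),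
    gdy k mu (gpy s f) = gpy s (gdy (s^-1%g k) mu f);

  (** Evaluation at y_{n+1} = x_j: the chain rule *)
  gdx_at : forall m n i j mu (f : gf ops m n.+1),
    gdx i mu (gat j f) =
    gat j (gdx i mu f + (if i == j then gdy ord_max mu f else 0));
  gdy_at : forall m n j k mu (f : gf ops m n.+1),
    gdy k mu (gat j f) = gat j (gdy (lift ord_max k) mu f);

  (** delta^3_mu(y_k - x_j) depends on y_k - x_j only *)
  gdx_delta_neq : forall m n (k : 'I_n) (j i : 'I_m) mu nu (f : gf ops m n.-1),
    i != j -> gdx i mu (gdelta k j nu f) = gdelta k j nu (gdx i mu f);
  gdxy_delta : forall m n (k : 'I_n) (j : 'I_m) mu nu (f : gf ops m n.-1),
    gdx j mu (gdelta k j nu f) + gdy k mu (gdelta k j nu f) =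
    gdelta k j nu (gdx j mu f);
  gdy_delta : forall m n (k : 'I_n) (j : 'I_m) l mu nu (f : gf ops m n.-1),
    gdy (lift k l) mu (gdelta k j nu f) = gdelta k j nu (gdy l mu f);

  (** Simultaneous configurations *)
  tsmear_dy : forall m n (k : 'I_n) i phi (f : tgf ops m n), test_function phi ->
    tsmear k phi (tdy k i f) = - tsmear k (ddir (delta_mx ord0 i) phi) f;
  tsmear_sep : forall m n (k : 'I_n) (f : tgf ops m n),
    (forall phi, test_function phi -> tsmear k phi f = 0) -> f = 0;
  (* int phi(y_k) delta^3(y_k - x_j) f d^3y_k = phi(x_j) f *)
  tsmear_delta : forall m n (k : 'I_n) (j : 'I_m) phi (f : tgf ops m n.-1),
    test_function phi -> tsmear k phi (tdelta k j f) = tmulx j phi f;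
  tL2_linear : forall m n (k : 'I_n) (a : R[i]) (f g : tgf ops m n),
    tL2 k f -> tL2 k g -> tL2 k (a *: f + g);
  (* - Delta is injective on square-integrable functions *)
  tinvlapK : forall m n (k : 'I_n) (f : tgf ops m n), tL2 k f ->
    tinvlap k (- \sum_(i < 3) tdy k i (tdy k i f)) = f;

  (** Restriction to simultaneous configurations *)
  tdt_restr : forall m n (f : gf ops m n),
    tdt (restr f) =
    restr (\sum_(j < m) gdx j tm f + \sum_(k < n) gdy k tm f);
  tdx_restr : forall m n j i (f : gf ops m n),
    tdx j i (restr f) = restr (gdx j (sp i) f);
  tdy_restr : forall m n k i (f : gf ops m n),
    tdy k i (restr f) = restr (gdy k (sp i) f);
  tat_restr : forall m n (j : 'I_m) (f : gf ops m n.+1),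
    tat j (restr f) = restr (gat j f);
  (* delta^3_mu = (delta^3, 0, 0, 0) on a surface of constant time *)
  restr_delta : forall m n (k : 'I_n) (j : 'I_m) mu (f : gf ops m n.-1),
    restr (gdelta k j mu f) = if mu == tm then tdelta k j (restr f) else 0
}.

Section Laws.
Variable R : realType.
Local Notation C := (complex R).

(** * Dirac matrices *)

Definition metric (mu nu : 'I_4) : C :=
  if mu == nu then (if mu == tm then 1 else -1) else 0.

Definition dirac_matrices (gamma : 'I_4 -> 'M[C]_4) : Prop :=
  (forall mu nu, gamma mu *m gamma nu + gamma nu *m gamma mu =
                 (2 * metric mu nu)%:M) /\
  (forall mu, map_mx (@conjc R) (gamma mu)^T = metric mu mu *: gamma mu).

Definition gamma_low (gamma : 'I_4 -> 'M[C]_4) (nu : 'I_4) : 'M[C]_4 :=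
  \sum_rho metric nu rho *: gamma rho.

Definition alphaD (gamma : 'I_4 -> 'M[C]_4) (i : 'I_3) : 'M[C]_4 :=
  gamma tm *m gamma (sp i).

Definition betaD (gamma : 'I_4 -> 'M[C]_4) : 'M[C]_4 := gamma tm.

(* The matrix M acting on the spin index s_j. *)
Definition spin_act (V : lmodType C) (m : nat) (j : 'I_m) (M : 'M[C]_4)
    (f : {ffun 'I_m -> 'I_4} -> V) (s : {ffun 'I_m -> 'I_4}) : V :=
  \sum_a M (s j) a *: f (upd s j a).

(** * Vectors, antisymmetric tensors, and the exterior derivative *)

(* epsilon^{ijl}, as the product of differences divided by 2 *)
Definition levi (i j l : 'I_3) : C :=
  (j%:R - i%:R) * (l%:R - i%:R) * (l%:R - j%:R) / 2.

Section Fields.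
Variable K : calculus R.

Definition wave : Type := forall m n : nat,
  {ffun 'I_m -> 'I_4} -> {ffun 'I_n -> 'I_4} -> gf K m n.

Definition wave_function (Psi : wave) : Prop :=
  (forall m n (s : {perm 'I_m}) (a : {ffun 'I_m -> 'I_4})
      (mu : {ffun 'I_n -> 'I_4}),
    gpx s (Psi m n [ffun i => a (s i)] mu) = (-1) ^+ s *: Psi m n a mu) /\
  (forall m n (s : {perm 'I_n}) (a : {ffun 'I_m -> 'I_4})
      (mu : {ffun 'I_n -> 'I_4}),
    gpy s (Psi m n a [ffun i => mu (s i)]) = Psi m n a mu).

(* Components T_{s, mu, nu} in which each photon slot carries either the pair
   mu_k nu_k, or mu_k alone; in the latter case nu_k is a dummy argument. *)
Definition tensor (V : nat -> nat -> lmodType C) (m n : nat) : Type :=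
  {ffun 'I_m -> 'I_4} -> {ffun 'I_n -> 'I_4} -> {ffun 'I_n -> 'I_4} -> V m n.

(* d_k: replaces mu_k by the pair mu_k nu_k *)
Definition dext (m n : nat) (k : 'I_n) (T : tensor (gf K) m n)
    : tensor (gf K) m n :=
  fun s mu nu => gdy k (mu k) (T s (upd mu k (nu k)) nu)
                 - gdy k (nu k) (T s mu nu).

(* the product of the (commuting) d_k, k in D, applied to Psi^(m,n) *)
Definition dset (Psi : wave) (m n : nat) (D : {set 'I_n})
    : tensor (gf K) m n :=
  foldr (@dext m n) (fun s mu _ => Psi m n s mu) (enum D).

Definition field_strength (Psi : wave) (m n : nat) : tensor (gf K) m n :=
  @dset Psi m n [set: 'I_n]%SET.

Definition tfield (Psi : wave) (m n : nat) : tensor (tgf K) m n :=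
  fun s mu nu => restr (field_strength Psi s mu nu).

(* E^i = F_{0i} and B^i = - 1/2 eps^{ijl} F_{jl} in slot k; the arguments mu_k
   and nu_k of the result are dummies *)
Definition elec (m n : nat) (k : 'I_n) (T : tensor (tgf K) m n) (i : 'I_3)
    : tensor (tgf K) m n :=
  fun s mu nu => T s (upd mu k tm) (upd nu k (sp i)).

Definition magn (m n : nat) (k : 'I_n) (T : tensor (tgf K) m n) (i : 'I_3)
    : tensor (tgf K) m n :=
  fun s mu nu => - 2^-1 *: \sum_(j < 3) \sum_(l < 3)
    levi i j l *: T s (upd mu k (sp j)) (upd nu k (sp l)).

(* the column (E, B)_k: the tensor antisymmetric in mu_k nu_k whose electric
   and magnetic components in slot k are E and B *)
Definition column (m n : nat) (k : 'I_n) (E B : 'I_3 -> tensor (tgf K) m n)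
    : tensor (tgf K) m n :=
  fun s mu nu =>
    match unlift tm (mu k), unlift tm (nu k) with
    | None, None => 0
    | None, Some i => E i s mu nu
    | Some i, None => - E i s mu nu
    | Some j, Some l => - \sum_(i < 3) levi i j l *: B i s mu nu
    end.

Definition curl (m n : nat) (k : 'I_n) (W : 'I_3 -> tensor (tgf K) m n)
    (i : 'I_3) : tensor (tgf K) m n :=
  fun s mu nu => \sum_(j < 3) \sum_(l < 3)
    levi i j l *: tdy k j (W l s mu nu).

Definition dive (m n : nat) (k : 'I_n) (W : 'I_3 -> tensor (tgf K) m n)
    : tensor (tgf K) m n :=
  fun s mu nu => \sum_(i < 3) tdy k i (W i s mu nu).

(** * The laws *)

Variable gamma : 'I_4 -> 'M[C]_4.
Variables ex mx : R.

Definition dirac_law (Psi : wave) : Prop :=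
  forall m n (j : 'I_m) (s : {ffun 'I_m -> 'I_4}) (mu : {ffun 'I_n -> 'I_4}),
    'i *: (\sum_rho spin_act j (gamma rho) (fun s' => gdx j rho (Psi m n s' mu)) s)
    - mx%:C *: Psi m n s mu =
    (ex * Num.sqrt n.+1%:R)%:C *:
      \sum_rho spin_act j (gamma rho) (fun s' =>
        gat j (Psi m n.+1 s' (insert (n := n.+1) ord_max mu rho))) s.

Definition gdy_up (m n : nat) (k : 'I_n) (mu : 'I_4) (f : gf K m n)
    : gf K m n := \sum_nu metric mu nu *: gdy k nu f.

(* S_{[mu nu]} *)
Definition antisym (V : lmodType C) (S : 'I_4 -> 'I_4 -> V) (mu nu : 'I_4)
    : V := 2^-1 *: (S mu nu - S nu mu).

Definition maxwell_law (Psi : wave) : Prop :=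
  forall m n (k : 'I_n) (nu : 'I_4) (s : {ffun 'I_m -> 'I_4})
      (mu : {ffun 'I_n -> 'I_4}),
    2 *: \sum_rho gdy_up k rho
      (antisym (fun a b => gdy k a (Psi m n s (upd mu k b))) rho nu) =
    (ex / Num.sqrt n%:R)%:C *:
      \sum_(j < m) \sum_rho spin_act j (gamma rho *m gamma_low gamma nu) (fun s' =>
        gdelta k j rho (Psi m n.-1 s' (omit k mu))) s.

Definition coulomb_gauge (Psi : wave) : Prop :=
  forall m n (k : 'I_n) (s : {ffun 'I_m -> 'I_4}) (mu : {ffun 'I_n -> 'I_4}),
    \sum_(i < 3) gdy_up k (sp i) (Psi m n s (upd mu k (sp i))) = 0.

(* At fixed time the potential and field components are square-integrable
   functions of each photon position; D is the set of the photon slots in which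
   the field is taken. *)
Definition square_integrable (Psi : wave) : Prop :=
  forall m n (k : 'I_n) (D : {set 'I_n}) (s : {ffun 'I_m -> 'I_4})
      (mu nu : {ffun 'I_n -> 'I_4}),
    tL2 k (restr (dset Psi D s mu nu)).

(** * Hamiltonians *)

Definition Hfree_x (m n : nat) (j : 'I_m) (T : tensor (tgf K) m n)
    : tensor (tgf K) m n :=
  fun s mu nu =>
    - 'i *: (\sum_(i < 3)
        spin_act j (alphaD gamma i) (fun s' => tdx j i (T s' mu nu)) s)
    + mx%:C *: spin_act j (betaD gamma) (fun s' => T s' mu nu) s.

Definition Hfree_y (m n : nat) (k : 'I_n) (T : tensor (tgf K) m n)
    : tensor (tgf K) m n :=
  column k (fun i s mu nu => 'i *: curl k (magn k T) i s mu nu)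
           (fun i s mu nu => - 'i *: curl k (elec k T) i s mu nu).

(* Sum over j of the term in F^(m,n+1).  Its signs are those of
   gamma^0 gamma^rho A_rho = A_0 - alpha . A, for A_mu = (A_0, -A). *)
Definition Hint_absorb (m n : nat) (T : tensor (tgf K) m n.+1)
    : tensor (tgf K) m n :=
  fun s mu nu =>
    let mu' := insert (n := n.+1) ord_max mu tm in
    let nu' := insert (n := n.+1) ord_max nu tm in
    (ex * Num.sqrt n.+1%:R)%:C *: \sum_(j < m) tat j (
      tinvlap ord_max (dive ord_max (elec ord_max T) s mu' nu')
      - \sum_(i < 3) spin_act j (alphaD gamma i) (fun s' =>
          tinvlap ord_max (curl ord_max (magn ord_max T) i s' mu' nu')) s).

(* delta^3(y_k - x_j) M_j F^(m,n-1), without y_k and mu_k nu_k *)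
Definition delta_term (m n : nat) (k : 'I_n) (j : 'I_m) (M : 'M[C]_4)
    (T : tensor (tgf K) m n.-1) : tensor (tgf K) m n :=
  fun s mu nu =>
    spin_act j M (fun s' => tdelta k j (T s' (omit k mu) (omit k nu))) s.

(* Sum over j and k of the term in F^(m,n-1).  Its factor -i is that of
   i d_0 E = i curl B - i J. *)
Definition Hint_emit (m n : nat) (T : tensor (tgf K) m n.-1)
    : tensor (tgf K) m n :=
  fun s mu nu => (- 'i * (ex / Num.sqrt n%:R)%:C) *:
    \sum_(j < m) \sum_(k < n)
      column k (fun i => delta_term k j (alphaD gamma i) T)
               (fun _ _ _ _ => 0) s mu nu.

End Fields.
End Laws.

Arguments field_strength {R K} Psi m n.
Arguments tfield {R K} Psi m n.

(* Main.v *)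
Require Import Defs.
From HB Require Import structures.
From mathcomp Require Import all_boot all_order all_fingroup all_algebra.
From mathcomp Require Import all_classical all_reals all_analysis.
From mathcomp Require Import complex ring.
Import Order.TTheory GRing.Theory Num.Theory.
Set Implicit Arguments.
Unset Strict Implicit.
Unset Printing Implicit Defensive.
Local Open Scope ring_scope.
Local Open Scope complex_scope.

(* On simultaneous configurations the time derivative is the sum of the time
   derivatives in all the particles.  The operators d_l commute with everything
   in the multi-time laws that acts on other variables, so each law survives
   when d_l is applied in the remaining photon slots.  For an electron, the Dirac
   law multiplied by gamma^0 gives the free Dirac Hamiltonian and a term in the
   potential of the extra photon; by the Coulomb gauge div E = - Delta A_0 and
   curl B = - Delta A there, so inverting - Delta recovers that potential.  For
   a photon slot, the restricted Maxwell law is Gauss's and Ampere's law, and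
   F = dA gives Faraday's law and div B = 0. *)

(** * Replacing, omitting and inserting entries of index tuples *)

Section Bookkeeping.
Variables (A : Type) (n : nat).
Implicit Types (k l : 'I_n) (c : {ffun 'I_n -> A}) (d : {ffun 'I_n.-1 -> A}).

Lemma upd_same c k a : upd c k a k = a.
Proof. by rewrite ffunE eqxx. Qed.

Lemma upd_other c k l a : l != k -> upd c k a l = c l.
Proof. by move=> lk; rewrite ffunE (negbTE lk). Qed.

Lemma updK c k a b : upd (upd c k a) k b = upd c k b.
Proof. by apply/ffunP => l; rewrite !ffunE; case: eqP. Qed.

Lemma upd_id c k : upd c k (c k) = c.
Proof. by apply/ffunP => l; rewrite ffunE; case: eqP => [->|]. Qed.

Lemma updC c k l a b : k != l -> upd (upd c k a) l b = upd (upd c l b) k a.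
Proof.
move=> kl; apply/ffunP => i; rewrite !ffunE.
by case: (eqVneq i l) => // ->; rewrite eq_sym (negbTE kl).
Qed.

Lemma omit_upd_lift c k (l : 'I_n.-1) a :
  omit k (upd c (lift k l) a) = upd (omit k c) l a.
Proof. by apply/ffunP => i; rewrite !ffunE (inj_eq lift_inj). Qed.

Lemma upd_insert k d a b : upd (insert k d a) k b = insert k d b.
Proof.
apply/ffunP => l; rewrite !ffunE; case: eqP => [->|]; first by rewrite unlift_none.
by move/eqP; rewrite eq_sym => /unlift_some [j -> ->].
Qed.

Lemma insert_lift k d a (l : 'I_n.-1) : insert k d a (lift k l) = d l.
Proof. by rewrite ffunE liftK. Qed.

Lemma insert_upd k d a (l : 'I_n.-1) b :
  insert k (upd d l b) a = upd (insert k d a) (lift k l) b.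
Proof.
apply/ffunP => i; rewrite !ffunE; case: unliftP => [j ->|->].
  by rewrite ffunE (inj_eq lift_inj).
by rewrite (negbTE (neq_lift _ _)).
Qed.

End Bookkeeping.

(** * Matrices acting on a single spin index *)

Section SpinAction.
Variables (R : realType) (m : nat) (j : 'I_m).
Local Notation C := (complex R).
Implicit Types (V W : lmodType C) (M N : 'M[C]_4) (s : {ffun 'I_m -> 'I_4}).

(** Derivatives, evaluation at [x_j], multiplication by delta and restriction are all linear, so
    this one rule moves any of them past a spin matrix. *)
Lemma spin_act_linear V W (h : {linear V -> W}) M (f : {ffun 'I_m -> 'I_4} -> V) s :
  spin_act j M (fun s' => h (f s')) s = h (spin_act j M f s).
Proof. by rewrite /spin_act linear_sum; apply: eq_bigr => a _; rewrite linearZ. Qed.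

Lemma spin_actB V M (f g : {ffun 'I_m -> 'I_4} -> V) s :
  spin_act j M (fun s' => f s' - g s') s = spin_act j M f s - spin_act j M g s.
Proof. by rewrite /spin_act -sumrB; apply: eq_bigr => a _; rewrite scalerBr. Qed.

Lemma spin_act0 V M s : spin_act j M (fun=> 0 : V) s = 0.
Proof. by rewrite /spin_act big1 // => a _; rewrite scaler0. Qed.

Lemma spin_act_sum V (I : finType) M (f : I -> {ffun 'I_m -> 'I_4} -> V) s :
  spin_act j M (fun s' => \sum_i f i s') s = \sum_i spin_act j M (f i) s.
Proof.
rewrite /spin_act exchange_big; apply: eq_bigr => a _.
by rewrite scaler_sumr.
Qed.

Lemma spin_actZ V M c (f : {ffun 'I_m -> 'I_4} -> V) s :
  spin_act j M (fun s' => c *: f s') s = c *: spin_act j M f s.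
Proof.
by rewrite /spin_act scaler_sumr; apply: eq_bigr => a _; rewrite !scalerA mulrC.
Qed.

Lemma spin_actN V M (f : {ffun 'I_m -> 'I_4} -> V) s :
  spin_act j (- M) f s = - spin_act j M f s.
Proof. by rewrite /spin_act -sumrN; apply: eq_bigr => a _; rewrite mxE scaleNr. Qed.

Lemma spin_act_oppf V M (f : {ffun 'I_m -> 'I_4} -> V) s :
  spin_act j M (fun s' => - f s') s = - spin_act j M f s.
Proof. by rewrite /spin_act -sumrN; apply: eq_bigr => a _; rewrite scalerN. Qed.

Lemma spin_act1 V (f : {ffun 'I_m -> 'I_4} -> V) s : spin_act j 1%:M f s = f s.
Proof.
rewrite /spin_act (bigD1 (s j)) //= mxE eqxx scale1r upd_id big1 ?addr0 // => a.
by rewrite mxE eq_sym => /negbTE ->; rewrite scale0r.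
Qed.

Lemma spin_actM V M N (f : {ffun 'I_m -> 'I_4} -> V) s :
  spin_act j M (spin_act j N f) s = spin_act j (M *m N) f s.
Proof.
rewrite /spin_act; under eq_bigr do rewrite scaler_sumr.
rewrite exchange_big; apply: eq_bigr => a _; rewrite mxE scaler_suml.
by apply: eq_bigr => b _; rewrite scalerA upd_same updK.
Qed.

Lemma eq_spin_act V M (f g : {ffun 'I_m -> 'I_4} -> V) s :
  f =1 g -> spin_act j M f s = spin_act j M g s.
Proof. by move=> fg; apply: eq_bigr => a _; rewrite fg. Qed.

End SpinAction.

(** * Consequences of the Clifford relations and the metric *)

Section Gamma.
Variables (R : realType) (gamma : 'I_4 -> 'M[complex R]_4).
Hypothesis gammaP : dirac_matrices gamma.

Lemma gamma_tm_sq : gamma tm *m gamma tm = 1%:M.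
Proof.
have [/(_ tm tm) + _] := gammaP; rewrite /metric !eqxx mulr1 -mulr2n.
rewrite -[2%:M]/((1 *+ 2)%:M) raddfMn /= => H.
suff: (2%:R : complex R) *: (gamma tm *m gamma tm) = 2%:R *: 1%:M.
  by move/scalerI; apply; rewrite pnatr_eq0.
by rewrite !scaler_nat.
Qed.

Lemma gamma_low_tm : gamma_low gamma tm = gamma tm.
Proof.
rewrite /gamma_low (bigD1 tm) //= {1}/metric eqxx scale1r big1 ?addr0 // => r.
by rewrite /metric eq_sym => /negbTE ->; rewrite scale0r.
Qed.

Lemma gamma_low_sp i : gamma_low gamma (sp i) = - gamma (sp i).
Proof.
rewrite /gamma_low (bigD1 (sp i)) //= {1}/metric eqxx.
rewrite -[sp i == tm]/false scaleN1r big1 ?addr0 // => r.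
by rewrite /metric eq_sym => /negbTE ->; rewrite scale0r.
Qed.

End Gamma.

(** * Index sums and the Levi-Civita symbol *)

Lemma sum_ord4 (V : nmodType) (f : 'I_4 -> V) :
  \sum_mu f mu = f tm + \sum_(i < 3) f (sp i).
Proof. by rewrite big_ord_recl. Qed.

(* Spatial indices are added modulo 3, so that (i, i + 1, i + 2) is cyclic. *)
Lemma sum_ord3 (V : nmodType) (i : 'I_3) (f : 'I_3 -> V) :
  \sum_j f j = f i + f (i + 1) + f (i + 2).
Proof.
rewrite !big_ord_recl big_ord0 addr0 addrA.
have -> : lift ord0 ord0 = 1 :> 'I_3 by apply/val_inj.
have -> : lift ord0 (lift ord0 ord0) = 2 :> 'I_3 by apply/val_inj.
have -> : ord0 = 0 :> 'I_3 by apply/val_inj.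
case: i => [[|[|[|//]]] lt_i].
- have -> : Ordinal lt_i = 0 by apply/val_inj.
  by rewrite !add0r.
- have -> : Ordinal lt_i = 1 by apply/val_inj.
  have -> : 1 + 2 = 0 :> 'I_3 by apply/val_inj.
  have -> : 1 + 1 = 2 :> 'I_3 by apply/val_inj.
  by rewrite -addrA addrC.
- have -> : Ordinal lt_i = 2 by apply/val_inj.
  have -> : 2 + 2 = 1 :> 'I_3 by apply/val_inj.
  have -> : 2 + 1 = 0 :> 'I_3 by apply/val_inj.
  by rewrite addrC addrA.
Qed.

Lemma ord3_shift (i : 'I_3) :
  (i + 1 + 1 = i + 2) * (i + 1 + 2 = i) * (i + 2 + 1 = i) * (i + 2 + 2 = i + 1).
Proof.
by case: i => [[|[|[|//]]] ?]; (split; [split; [split|]|]); apply/val_inj.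
Qed.

Section LeviCivita.
Variables (R : realType) (V : lmodType (complex R)).

Lemma levi_cyclic (i : 'I_3) :
  [/\ levi R i (i + 1) (i + 2) = 1 & levi R i (i + 2) (i + 1) = -1].
Proof.
case: i => [[|[|[|//]]] lt_i]; rewrite /levi.
- by rewrite -[nat_of_ord (_ + 1)]/1%N -[nat_of_ord (_ + 2)]/2%N /=; split; field.
- by rewrite -[nat_of_ord (_ + 1)]/2%N -[nat_of_ord (_ + 2)]/0%N /=; split; field.
- by rewrite -[nat_of_ord (_ + 1)]/0%N -[nat_of_ord (_ + 2)]/1%N /=; split; field.
Qed.

Lemma levi_rot i j l : levi R i j l = levi R j l i.
Proof. by rewrite /levi; ring. Qed.

Lemma levi_eq12 i l : levi R i i l = 0.
Proof. by rewrite /levi subrr !mul0r. Qed.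

Lemma levi_eq13 i l : levi R i l i = 0.
Proof. by rewrite levi_rot levi_rot levi_eq12. Qed.

Lemma levi_eq23 i l : levi R l i i = 0.
Proof. by rewrite levi_rot levi_eq12. Qed.

Lemma levi_sum i (G : 'I_3 -> 'I_3 -> V) :
  \sum_j \sum_l levi R i j l *: G j l = G (i + 1) (i + 2) - G (i + 2) (i + 1).
Proof.
rewrite (sum_ord3 i) !(sum_ord3 i (fun l => levi R i _ l *: _)).
rewrite !levi_eq12 !levi_eq13 !levi_eq23 !scale0r.
by have [-> ->] := levi_cyclic i; rewrite scale1r scaleN1r !(addr0, add0r).
Qed.

(** By [levi_sum] the bracket is the contraction of epsilon with [G], so this is the identity
    expressing a product of two epsilons through Kronecker deltas. *)
Lemma levi_dual j l (G : 'I_3 -> 'I_3 -> V) :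
  \sum_i levi R i j l *: (G (i + 1) (i + 2) - G (i + 2) (i + 1)) = G j l - G l j.
Proof.
have [e12 e21] := levi_cyclic j.
have /or3P [] : [|| l == j, l == j + 1 | l == j + 2].
- by case: j {e12 e21} l => [[|[|[|//]]] ?] [[|[|[|//]]] ?].
- by move=> /eqP ->; rewrite subrr big1 // => i _; rewrite levi_eq23 scale0r.
- move=> /eqP ->; rewrite (sum_ord3 j) levi_eq12 levi_eq13 levi_rot e12.
  by rewrite !scale0r scale1r addr0 add0r !ord3_shift.
- move=> /eqP ->; rewrite (sum_ord3 j) levi_eq12 levi_eq13 levi_rot e21.
  by rewrite !scale0r scaleN1r addr0 add0r !ord3_shift opprB.
Qed.

End LeviCivita.

(** * Products of exterior derivatives over sets of photon slots *)

Section ExteriorDerivative.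
Variables (R : realType) (K : calculus R).

(** In distinct slots the index updates are independent and the derivatives commute. The product of
    the [d_k] therefore does not depend on the order of enumeration. *)
Lemma dextC m n (k l : 'I_n) (T : tensor (gf K) m n) :
  dext k (dext l T) = dext l (dext k T).
Proof.
case: (eqVneq k l) => [-> //|kl]; have lk : l != k by rewrite eq_sym.
apply/funext => s; apply/funext => mu; apply/funext => nu; rewrite /dext.
rewrite !(upd_other _ _ kl) !(upd_other _ _ lk) (updC _ _ _ kl) !raddfB /=.
by rewrite ![gdy l _ (gdy k _ _)]gdyC addrACA.
Qed.

(** Exchange of two blocks is the form of commutativity that [catCA_perm_subst] extends to arbitrary
    permutations. *)
Lemma foldr_dext_catCA m n (T : tensor (gf K) m n) (r1 r2 r3 : seq 'I_n) :
  foldr (@dext _ K m n) T (r1 ++ r2 ++ r3) = foldr (@dext _ K m n) T (r2 ++ r1 ++ r3).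
Proof.
rewrite !foldr_cat; move: (foldr _ T r3) => {r3}T.
have dext_foldr k T' (r : seq 'I_n) :
    dext k (foldr (@dext _ K m n) T' r) = foldr (@dext _ K m n) (dext k T') r.
  by elim: r => //= l r IH; rewrite dextC IH.
elim: r1 T => //= k r IH T.
by rewrite IH dext_foldr.
Qed.

Lemma perm_foldr_dext m n (T : tensor (gf K) m n) (r1 r2 : seq 'I_n) :
  perm_eq r1 r2 -> foldr (@dext _ K m n) T r1 = foldr (@dext _ K m n) T r2.
Proof.
by move=> r12; apply: (catCA_perm_subst (foldr_dext_catCA T) r12).
Qed.

Lemma dset_seq (Psi : wave K) m n (D : {set 'I_n}) (r : seq 'I_n) :
  uniq r -> r =i D ->
  @dset _ K Psi m n D = foldr (@dext _ K m n) (fun s mu _ => Psi m n s mu) r.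
Proof.
move=> r_uniq rD; apply: perm_foldr_dext; apply: uniq_perm => // [|i].
  exact: enum_uniq.
by rewrite mem_enum rD.
Qed.

(** Only [d_k] reads the entry [nu k]; without that factor the entry is a dummy. *)
Lemma dset_nu (Psi : wave K) m n (D : {set 'I_n}) (k : 'I_n) s mu nu a :
  k \notin D ->
  @dset _ K Psi m n D s mu (upd nu k a) = dset Psi D s mu nu.
Proof.
rewrite -mem_enum /dset; elim: (enum D) mu => //= l r IH mu.
rewrite inE negb_or => /andP [kl kr].
by rewrite /dext upd_other 1?eq_sym // !IH.
Qed.

(** The field is taken in every slot except [k], where the vector potential with index [a] remains.
    It plays the role of [A_a] in one-photon electrodynamics. *)
Definition potential (Psi : wave K) m n (k : 'I_n) s mu nu (a : 'I_4) : gf K m n :=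
  dset Psi (~: [set k])%SET s (upd mu k a) nu.

Lemma potential_upd (Psi : wave K) m n (k : 'I_n) s mu nu a b c :
  @potential Psi m n k s (upd mu k a) (upd nu k b) c = potential Psi k s mu nu c.
Proof. by rewrite /potential updK dset_nu // !inE eqxx. Qed.

(** Enumerating [k] first makes [d_k] the outermost factor, which gives F = dA in slot [k]. *)
Lemma field_strengthE (Psi : wave K) m n (k : 'I_n) s mu nu :
  field_strength Psi m n s mu nu =
  gdy k (mu k) (potential Psi k s mu nu (nu k))
  - gdy k (nu k) (potential Psi k s mu nu (mu k)).
Proof.
rewrite /field_strength (@dset_seq _ _ _ _ (k :: enum (~: [set k])%SET)) /=.
- by rewrite /dext -/(dset Psi _ _ _ _) /potential upd_id.
- by rewrite enum_uniq mem_enum !inE eqxx.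
- by move=> l; rewrite !inE mem_enum !inE orbN.
Qed.

End ExteriorDerivative.

(** * The multi-time laws for the fields *)

Lemma gdy_up_tm (R : realType) (K : calculus R) m n k (f : gf K m n) :
  gdy_up k tm f = gdy k tm f.
Proof.
rewrite /gdy_up (bigD1 tm) //= /metric !eqxx scale1r big1 ?addr0 // => mu.
by rewrite eq_sym => /negbTE ->; rewrite scale0r.
Qed.

Lemma gdy_up_sp (R : realType) (K : calculus R) m n k i (f : gf K m n) :
  gdy_up k (sp i) f = - gdy k (sp i) f.
Proof.
rewrite /gdy_up (bigD1 (sp i)) //= /metric eqxx.
rewrite -[sp i == tm]/false scaleN1r big1 ?addr0 // => mu.
by rewrite eq_sym => /negbTE ->; rewrite scale0r.
Qed.

Section LawsForFields.
Variables (R : realType) (K : calculus R) (gamma : 'I_4 -> 'M[complex R]_4).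
Variables (ex mx : R) (Psi : wave K).
Arguments Psi : clear implicits.
Hypothesis gammaP : dirac_matrices gamma.

(** The Dirac law multiplied by gamma^0 and solved for i d_0 in the time of [x_j]; [f' rho] is the
    component with index [rho] in the extra photon slot, before evaluation at [x_j]. *)
Definition dirac_rhs m n (j : 'I_m) (f : {ffun 'I_m -> 'I_4} -> gf K m n)
    (f' : 'I_4 -> {ffun 'I_m -> 'I_4} -> gf K m n.+1) s : gf K m n :=
  - 'i *: (\sum_i spin_act j (alphaD gamma i) (fun s' => gdx j (sp i) (f s')) s)
  + mx%:C *: spin_act j (betaD gamma) f s
  + (ex * Num.sqrt n.+1%:R)%:C *:
      \sum_rho spin_act j (gamma tm *m gamma rho) (fun s' => gat j (f' rho s')) s.

(** Evaluating the last photon at [x_j] leaves the others alone; slot [k] of [n] is slot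
    [lift ord_max k] of [n.+1]. *)
Lemma gdy_dirac_rhs m n (j : 'I_m) f f' s (k : 'I_n) b :
  gdy k b (dirac_rhs j f f' s) =
  dirac_rhs j (fun s' => gdy k b (f s'))
    (fun rho s' => gdy (lift ord_max k) b (f' rho s')) s.
Proof.
rewrite /dirac_rhs !linearD !linearZ /=; congr (_ *: _ + _ *: _ + _ *: _).
- rewrite linear_sum; apply: eq_bigr => i _ /=; rewrite -spin_act_linear.
  by apply: eq_spin_act => s'; rewrite /= gdxyC.
- by rewrite -spin_act_linear.
- rewrite linear_sum; apply: eq_bigr => i _ /=; rewrite -spin_act_linear.
  by apply: eq_spin_act => s'; rewrite /= gdy_at.
Qed.

Lemma dirac_rhsB m n (j : 'I_m) f f' g g' s :
  @dirac_rhs m n j f f' s - dirac_rhs j g g' s =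
  dirac_rhs j (fun s' => f s' - g s') (fun rho s' => f' rho s' - g' rho s') s.
Proof.
rewrite /dirac_rhs 2!opprD addrACA [X in X + _ = _]addrACA -!scalerBr.
congr (_ *: _ + _ *: _ + _ *: _).
- rewrite -sumrB; apply: eq_bigr => i _; rewrite -spin_actB.
  by apply: eq_spin_act => s'; rewrite raddfB.
- by rewrite -spin_actB.
- rewrite -sumrB; apply: eq_bigr => i _; rewrite -spin_actB.
  by apply: eq_spin_act => s'; rewrite raddfB.
Qed.

(** Invariant of the induction over photon slots: the same [d_l] act on [T] and on the first [n]
    slots of [T'], whose last slot keeps its vector index [rho]. The value [a] only fills the last
    entry of [nu]. *)
Definition dirac_hamiltonian m n (T : tensor (gf K) m n) (T' : tensor (gf K) m n.+1) :
    Prop :=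
  forall j s mu nu a,
    'i *: gdx j tm (T s mu nu) =
    dirac_rhs j (fun s' => T s' mu nu)
      (fun rho s' => T' s' (insert (n := n.+1) ord_max mu rho)
                           (insert (n := n.+1) ord_max nu a)) s.

Lemma dirac_hamiltonian_dext m n (T : tensor (gf K) m n) (T' : tensor (gf K) m n.+1)
    (k : 'I_n) :
  dirac_hamiltonian T T' -> dirac_hamiltonian (dext k T) (dext (lift ord_max k) T').
Proof.
move=> H j s mu nu a; rewrite {1}/dext raddfB /= !gdxyC scalerBr -!['i *: gdy _ _ _]linearZ /=.
rewrite !(H _ _ _ _ a) !gdy_dirac_rhs dirac_rhsB; congr dirac_rhs.
apply/funext => rho; apply/funext => s'.
by rewrite /dext !(@insert_lift _ n.+1) (@insert_upd _ n.+1).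
Qed.

(** Listing the other slots as images under [lift k] lets inductions run in parallel with a function
    having one photon fewer. *)
Lemma dset_setC1 m n (k : 'I_n) :
  @dset _ K Psi m n (~: [set k])%SET =
  foldr (@dext _ K m n) (fun s mu _ => Psi m n s mu)
    (map (lift k) (enum [set: 'I_n.-1]%SET)).
Proof.
apply: dset_seq; first by rewrite (map_inj_uniq lift_inj) enum_uniq.
move=> i; rewrite !inE; case: (unliftP k i) => [l ->|->].
  by rewrite mem_map ?mem_enum ?inE 1?eq_sym ?neq_lift //; exact: lift_inj.
by rewrite eqxx; apply/mapP => -[l _] /eqP; rewrite (negbTE (neq_lift _ _)).
Qed.

Lemma dirac_field :
  dirac_law gamma ex mx Psi ->
  forall m n j s mu nu a,
  'i *: gdx j tm (field_strength Psi m n s mu nu) =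
  dirac_rhs j (fun s' => field_strength Psi m n s' mu nu)
    (fun rho s' => potential Psi (ord_max : 'I_n.+1) s'
       (insert (n := n.+1) ord_max mu tm) (insert (n := n.+1) ord_max nu a) rho) s.
Proof.
move=> dirac m n j s mu nu a.
have H0 : dirac_hamiltonian (fun s mu _ => Psi m n s mu)
    (fun s mu _ => Psi m n.+1 s mu).
  move=> {}j {}s {}mu _ _.
  (* The Dirac law is multiplied by gamma^0: its square 1 frees the time derivative, and the
     remaining products are alpha and beta. *)
  have := eq_spin_act j (gamma tm) s (fun s' => dirac m n j s' mu).
  rewrite spin_actB !spin_actZ !spin_act_sum.
  under eq_bigr do rewrite spin_actM.
  under [X in _ = _ *: X]eq_bigr do rewrite spin_actM.
  rewrite sum_ord4 gamma_tm_sq // spin_act1 scalerDr => /(canRL (subrK _)).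
  move/(canRL (addrK _)) => ->; rewrite /dirac_rhs scaleNr.
  by rewrite addrC [X in _ + X = _]addrC addrA.
have Hr (r : seq 'I_n) : dirac_hamiltonian
    (foldr (@dext _ K m n) (fun s mu _ => Psi m n s mu) r)
    (foldr (@dext _ K m n.+1) (fun s mu _ => Psi m n.+1 s mu) (map (lift ord_max) r)).
  by elim: r => //= k r IH; apply: dirac_hamiltonian_dext.
rewrite /field_strength /dset (Hr _ j s mu nu a); congr dirac_rhs.
apply/funext => rho; apply/funext => s'.
by rewrite /potential (@upd_insert _ n.+1) dset_setC1.
Qed.

(** This is d^rho F_(rho nu) for F = dA, with the factor 2 of the law absorbed into the
    antisymmetrization. *)
Definition maxwell_lhs m n (k : 'I_n) (A : 'I_4 -> gf K m n) nu : gf K m n :=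
  \sum_rho gdy_up k rho (gdy k rho (A nu) - gdy k nu (A rho)).

Definition maxwell_rhs m n (k : 'I_n) nu (f : {ffun 'I_m -> 'I_4} -> gf K m n.-1) s :
    gf K m n :=
  (ex / Num.sqrt n%:R)%:C *: \sum_(j < m) \sum_rho
    spin_act j (gamma rho *m gamma_low gamma nu) (fun s' => gdelta k j rho (f s')) s.

Lemma gdy_maxwell_lhs m n (k : 'I_n) A nu l b :
  gdy l b (@maxwell_lhs m n k A nu) = maxwell_lhs k (fun a => gdy l b (A a)) nu.
Proof.
rewrite /maxwell_lhs linear_sum; apply: eq_bigr => rho _ /=.
rewrite /gdy_up linear_sum; apply: eq_bigr => mu _ /=.
by rewrite linearZ /= gdyC raddfB /= ![gdy l b (gdy k _ _)]gdyC.
Qed.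

Lemma maxwell_lhsB m n (k : 'I_n) A B nu :
  @maxwell_lhs m n k A nu - maxwell_lhs k B nu = maxwell_lhs k (fun a => A a - B a) nu.
Proof.
rewrite /maxwell_lhs -sumrB; apply: eq_bigr => rho _.
rewrite /gdy_up -sumrB; apply: eq_bigr => mu _.
by rewrite -scalerBr -raddfB !raddfB /= addrACA -opprD.
Qed.

(** The delta involves [y_k] and [x_j] only, so derivatives in the other photon variables pass
    through it. *)
Lemma gdy_maxwell_rhs m n (k : 'I_n) nu f s (l : 'I_n.-1) b :
  gdy (lift k l) b (@maxwell_rhs m n k nu f s) =
  maxwell_rhs k nu (fun s' => gdy l b (f s')) s.
Proof.
rewrite /maxwell_rhs linearZ /= linear_sum; congr (_ *: _).
apply: eq_bigr => j _ /=; rewrite linear_sum; apply: eq_bigr => rho _ /=.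
by rewrite -spin_act_linear; apply: eq_spin_act => s'; rewrite /= gdy_delta.
Qed.

Lemma maxwell_rhsB m n (k : 'I_n) nu f g s :
  @maxwell_rhs m n k nu f s - maxwell_rhs k nu g s =
  maxwell_rhs k nu (fun s' => f s' - g s') s.
Proof.
rewrite /maxwell_rhs -scalerBr; congr (_ *: _).
rewrite -sumrB; apply: eq_bigr => j _; rewrite -sumrB; apply: eq_bigr => rho _.
by rewrite -spin_actB; apply: eq_spin_act => s'; rewrite raddfB.
Qed.

Lemma maxwell_field :
  maxwell_law gamma ex Psi ->
  forall m n (k : 'I_n) s mu nu a,
  maxwell_lhs k (potential Psi k s mu nu) a =
  maxwell_rhs k a (fun s' => field_strength Psi m n.-1 s' (omit k mu) (omit k nu)) s.
Proof.
move=> maxwell m n k s mu nu a; rewrite /potential dset_setC1.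
rewrite /field_strength /dset.
elim: (enum _) s mu nu => [|l r IH] s mu nu /=.
  rewrite /maxwell_rhs -maxwell /maxwell_lhs scaler_sumr; apply: eq_bigr => rho _.
  rewrite /gdy_up scaler_sumr; apply: eq_bigr => b _.
  by rewrite /antisym !linearZ /= !scalerA mulfVK // pnatr_eq0.
move: (foldr _ _ (map _ r)) (foldr _ _ r) IH => T T' IH.
have kl : k != lift k l := neq_lift _ _.
have lk : lift k l != k by rewrite eq_sym.
have omitE (c : {ffun 'I_n -> 'I_4}) : omit k c l = c (lift k l) by rewrite ffunE.
(* The induction hypothesis is differentiated in slot [lift k l]. The difference of its instances
   with the two indices of that slot interchanged is [d_l] applied to the law. *)
have step b c :
    gdy (lift k l) b
      (maxwell_lhs k (fun a => T s (upd (upd mu (lift k l) c) k a) nu) a) =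
    gdy (lift k l) b (maxwell_rhs k a (fun s' => T' s' (upd (omit k mu) l c) (omit k nu)) s).
  by rewrite IH omit_upd_lift.
have := congr2 (fun x y => x - y) (step (mu (lift k l)) (nu (lift k l)))
  (step (nu (lift k l)) (mu (lift k l))).
rewrite !gdy_maxwell_lhs !gdy_maxwell_rhs maxwell_lhsB maxwell_rhsB.
have -> : upd (omit k mu) l (mu (lift k l)) = omit k mu by rewrite -omitE upd_id.
rewrite upd_id -!omitE => E.
rewrite [in RHS]/dext -E; congr maxwell_lhs; apply/funext => b.
by rewrite /dext upd_other // -!omitE [upd (upd mu k _) _ _]updC.
Qed.

(** The divergence in slot [k] commutes with every [d_l] in another slot, so the gauge condition
    passes from Psi to the potential. *)
Lemma coulomb_field :
  coulomb_gauge Psi ->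
  forall m n (k : 'I_n) s mu nu,
  \sum_(i < 3) gdy k (sp i) (potential Psi k s mu nu (sp i)) = 0 :> gf K m n.
Proof.
move=> coulomb m n k s mu nu; rewrite /potential dset_setC1.
elim: (enum _) s mu nu => [|l r IH] s mu nu /=.
  (* Raising a spatial index changes the sign. *)
  apply/oppr_inj; rewrite oppr0 -sumrN -[RHS](coulomb m n k s mu).
  by apply: eq_bigr => i _; rewrite gdy_up_sp.
rewrite /dext.
have kl : k != lift k l := neq_lift _ _.
under eq_bigr => i _.
  rewrite raddfB /= upd_other 1?eq_sym // updC // ![gdy k _ (gdy (lift k l) _ _)]gdyC.
  over.
rewrite sumrB -!(linear_sum (gdy (lift k l) _)) /=.
by rewrite !IH !linear0 addr0.
Qed.

End LawsForFields.

(** * Equal-time field equations and recovery of the potential *)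

Section SimultaneousFields.
Variables (R : realType) (K : calculus R) (gamma : 'I_4 -> 'M[complex R]_4).
Variables (ex mx : R) (Psi : wave K).
Arguments Psi : clear implicits.

Section Slot.
Variables (m n : nat) (k : 'I_n) (s : {ffun 'I_m -> 'I_4}).
Variables (mu nu : {ffun 'I_n -> 'I_4}).
Local Notation A := (potential Psi k s mu nu).
Local Notation F a b := (gdy k a (A b) - gdy k b (A a)).

Lemma elec_tfield i : elec k (tfield Psi m n) i s mu nu = restr (F tm (sp i)).
Proof. by rewrite /elec /tfield (field_strengthE _ k) !upd_same !potential_upd. Qed.

(** Both orders of the spatial pair contribute equally by antisymmetry of F, which cancels the
    factor 1/2. *)
Lemma magn_tfield i :
  magn k (tfield Psi m n) i s mu nu = - restr (F (sp (i + 1)) (sp (i + 2))).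
Proof.
rewrite /magn levi_sum /tfield !(field_strengthE _ k) !upd_same !potential_upd.
rewrite -raddfB /= -[X in restr (_ - X)]opprB opprK -mulr2n raddfMn /=.
by rewrite scaleNr -[restr _ *+ 2]scaler_nat scalerA mulVf ?scale1r // pnatr_eq0.
Qed.

Lemma curlE (W : 'I_3 -> tensor (tgf K) m n) i :
  curl k W i s mu nu =
  tdy k (i + 1) (W (i + 2) s mu nu) - tdy k (i + 2) (W (i + 1) s mu nu).
Proof. by rewrite /curl levi_sum. Qed.

Lemma curl_magn_tfield i :
  curl k (magn k (tfield Psi m n)) i s mu nu =
  restr (\sum_j gdy k (sp j) (F (sp j) (sp i))).
Proof.
rewrite curlE !magn_tfield !ord3_shift (sum_ord3 i) subrr raddf0 add0r.
rewrite [RHS]raddfD /= -!tdy_restr !(raddfN (tdy k _)) opprK; congr (_ + _).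
by rewrite -raddfN -raddfN opprB.
Qed.

(** This is ddA = 0: the six second derivatives cancel in pairs. *)
Lemma dive_magn_tfield : dive k (magn k (tfield Psi m n)) s mu nu = 0.
Proof.
rewrite /dive; under eq_bigr => i _ do rewrite magn_tfield raddfN /= tdy_restr.
rewrite sumrN -raddf_sum /= -[RHS]oppr0; congr (- _); rewrite -[RHS](raddf0 restr).
congr (restr _); under eq_bigr => i _ do rewrite raddfB /=.
rewrite sumrB; apply/eqP; rewrite subr_eq0; apply/eqP.
rewrite !(sum_ord3 0) !add0r.
have -> : 1 + 1 = 2 :> 'I_3 by apply/val_inj.
have -> : 1 + 2 = 0 :> 'I_3 by apply/val_inj.
have -> : 2 + 1 = 0 :> 'I_3 by apply/val_inj.
have -> : 2 + 2 = 1 :> 'I_3 by apply/val_inj.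
rewrite (gdyC _ (sp 0) _ (sp 1)) (gdyC _ (sp 1) _ (sp 2)) (gdyC _ (sp 2) _ (sp 0)).
by rewrite [LHS]addrC addrA.
Qed.

(** The Bianchi identity d_0 F_jl = d_j F_0l - d_l F_0j, kept in tensor form to match the spatial
    entries of [column]. *)
Lemma faraday j l :
  restr (gdy k tm (F (sp j) (sp l))) =
  \sum_i levi R i j l *: curl k (elec k (tfield Psi m n)) i s mu nu.
Proof.
under eq_bigr do rewrite curlE !elec_tfield !tdy_restr.
rewrite (levi_dual j l (fun a b => restr (gdy k (sp a) (F tm (sp b))))).
rewrite !raddfB /= !(gdyC _ tm) (gdyC _ (sp l) _ (sp j)).
by rewrite opprK addrACA addNr addr0.
Qed.

(** At equal times delta^3_mu has only its time component, so only [rho = tm] survives. *)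
Lemma restr_maxwell_rhs a :
  restr (maxwell_rhs gamma ex k a
    (fun s' => field_strength Psi m n.-1 s' (omit k mu) (omit k nu)) s) =
  (ex / Num.sqrt n%:R)%:C *: \sum_(j < m)
    delta_term k j (gamma tm *m gamma_low gamma a) (tfield Psi m n.-1) s mu nu.
Proof.
rewrite /maxwell_rhs linearZ /= raddf_sum; congr (_ *: _); apply: eq_bigr => j _.
rewrite /= sum_ord4 raddfD /= -spin_act_linear /delta_term.
rewrite [X in _ + X]raddf_sum [X in _ + X]big1 ?addr0 => [|i _].
  by apply: eq_spin_act => s'; rewrite /= restr_delta eqxx.
rewrite /= -spin_act_linear.
rewrite -[RHS](spin_act0 j (tgf K m n) (gamma (sp i) *m gamma_low gamma a) s).
by apply: eq_spin_act => s'; rewrite /= restr_delta.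
Qed.

Lemma maxwell_lhs_tm : maxwell_lhs k A tm = \sum_i gdy k (sp i) (F tm (sp i)).
Proof.
rewrite /maxwell_lhs sum_ord4 subrr gdy_up_tm raddf0 add0r.
by apply: eq_bigr => i _; rewrite gdy_up_sp -raddfN /= opprB.
Qed.

Lemma maxwell_lhs_sp i :
  maxwell_lhs k A (sp i) =
  gdy k tm (F tm (sp i)) - \sum_j gdy k (sp j) (F (sp j) (sp i)).
Proof.
rewrite /maxwell_lhs sum_ord4 gdy_up_tm -sumrN; congr (_ + _).
by apply: eq_bigr => j _; rewrite gdy_up_sp.
Qed.

Hypothesis gammaP : dirac_matrices gamma.
Hypothesis maxwell : maxwell_law gamma ex Psi.

(** Component nu = 0 of the Maxwell law, with gamma^0 gamma_0 = 1. *)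
Lemma gauss :
  dive k (elec k (tfield Psi m n)) s mu nu =
  (ex / Num.sqrt n%:R)%:C *: \sum_(j < m)
    delta_term k j 1%:M (tfield Psi m n.-1) s mu nu.
Proof.
rewrite -(gamma_tm_sq gammaP) -{2}gamma_low_tm -restr_maxwell_rhs -maxwell_field //.
rewrite maxwell_lhs_tm raddf_sum; apply: eq_bigr => i _.
by rewrite elec_tfield tdy_restr.
Qed.

(** Spatial component of the Maxwell law; lowering the index turns gamma^0 gamma_i into -alpha_i,
    which is the sign of the current. *)
Lemma ampere i :
  restr (gdy k tm (F tm (sp i))) =
  curl k (magn k (tfield Psi m n)) i s mu nu
  - (ex / Num.sqrt n%:R)%:C *:
    \sum_(j < m) delta_term k j (alphaD gamma i) (tfield Psi m n.-1) s mu nu.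
Proof.
rewrite curl_magn_tfield; set J := _ *: _.
have <- : restr (maxwell_lhs k A (sp i)) = - J.
  rewrite (maxwell_field maxwell) restr_maxwell_rhs gamma_low_sp -scalerN -sumrN.
  congr (_ *: _); apply: eq_bigr => j _.
  by rewrite mulmxN /delta_term spin_actN.
by rewrite -raddfD maxwell_lhs_sp /= [X in _ = restr X]addrC subrK.
Qed.

Lemma photon_evolution :
  'i *: restr (gdy k tm (field_strength Psi m n s mu nu)) =
  Hfree_y k (tfield Psi m n) s mu nu + (- 'i * (ex / Num.sqrt n%:R)%:C) *:
    \sum_(j < m) column k (fun i => delta_term k j (alphaD gamma i) (tfield Psi m n.-1))
      (fun _ _ _ _ => 0) s mu nu.
Proof.
rewrite (field_strengthE _ k) /Hfree_y /column.
case: (unliftP tm (mu k)) => [j|] ->; case: (unliftP tm (nu k)) => [l|] ->.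
(* Two spatial indices: Faraday's law, and the source has no magnetic part. *)
- rewrite [X in _ + _ *: X]big1 ?scaler0 ?addr0 => [|j' _]; last first.
    by rewrite big1 ?oppr0 // => i _; rewrite scaler0.
  rewrite faraday scaler_sumr -sumrN; apply: eq_bigr => i _.
  by rewrite scaleNr scalerN opprK !scalerA mulrC.
(* Space index first: F_i0 = -F_0i reduces this to Ampere's law, used directly in the next case. *)
- rewrite -opprB !raddfN /= ampere scalerBr opprB sumrN scalerN -scaleNr mulNr opprK.
  by rewrite scalerA addrC.
- by rewrite ampere scalerBr scalerA -scaleNr mulNr.
- by rewrite subrr !raddf0 big1 // !(scaler0, addr0).
Qed.

Hypothesis coulomb : coulomb_gauge Psi.
Hypothesis sqint : square_integrable Psi.

Lemma tL2N (f : tgf K m n) : tL2 k f -> tL2 k (- f).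
Proof.
(* Closure is given for [a *: f + g], so -f is written as -2f + f. *)
move=> fL2; have := tL2_linear (-2) fL2 fL2.
by rewrite scaleNr scaler_nat mulr2n opprD subrK.
Qed.

(** div E = d_0 (sum of d_i A_i) - Delta A_0, and the Coulomb gauge removes the first term. *)
Lemma tinvlap_dive_elec :
  tinvlap k (dive k (elec k (tfield Psi m n)) s mu nu) = restr (A tm).
Proof.
rewrite -[RHS](@tinvlapK _ _ _ _ k); last exact: sqint.
congr tinvlap; rewrite /dive.
under eq_bigr => i _ do rewrite elec_tfield tdy_restr.
under [in RHS]eq_bigr => i _ do rewrite !tdy_restr.
rewrite -!raddf_sum -raddfN /=; congr (restr _).
under eq_bigr => i _ do rewrite raddfB /= gdyC.
by rewrite sumrB -(raddf_sum (gdy k tm)) /= coulomb_field // raddf0 sub0r.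
Qed.

(** In the Coulomb gauge curl B has i-th component Delta A_i. The minus sign appears because the
    lower component A_i is minus that of the vector potential. *)
Lemma tinvlap_curl_magn i :
  tinvlap k (curl k (magn k (tfield Psi m n)) i s mu nu) = - restr (A (sp i)).
Proof.
rewrite -[RHS](@tinvlapK _ _ _ _ k); last by apply: tL2N; exact: sqint.
congr tinvlap; rewrite curl_magn_tfield.
under [in RHS]eq_bigr => j _ do rewrite !raddfN /= !tdy_restr.
rewrite sumrN opprK -raddf_sum /=; congr (restr _).
under eq_bigr => j _ do rewrite raddfB /= [X in _ - X]gdyC.
by rewrite sumrB -(raddf_sum (gdy k (sp i))) /= coulomb_field // raddf0 subr0.
Qed.

End Slot.

(** The term gamma^0 gamma^rho A_rho splits into A_0 and alpha^i A_i, each recovered from the fields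
    by inverting -Delta. The entries [tm] in the last slots of [mu'] and [nu'] are dummies. *)
Lemma electron_evolution m n (j : 'I_m) s (mu nu : {ffun 'I_n -> 'I_4}) :
  dirac_matrices gamma -> dirac_law gamma ex mx Psi ->
  coulomb_gauge Psi -> square_integrable Psi ->
  'i *: restr (gdx j tm (field_strength Psi m n s mu nu)) =
  Hfree_x gamma mx j (tfield Psi m n) s mu nu
  + (ex * Num.sqrt n.+1%:R)%:C *:
    let k := ord_max : 'I_n.+1 in
    let mu' := insert (n := n.+1) ord_max mu tm in
    let nu' := insert (n := n.+1) ord_max nu tm in
    tat j (tinvlap k (dive k (elec k (tfield Psi m n.+1)) s mu' nu')
      - \sum_(i < 3) spin_act j (alphaD gamma i) (fun s' =>
          tinvlap k (curl k (magn k (tfield Psi m n.+1)) i s' mu' nu')) s).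
Proof.
move=> gammaP dirac coulomb sqint /=.
rewrite -linearZ /= (dirac_field gammaP dirac j s mu nu tm) /dirac_rhs !(raddfD restr) /=.
rewrite /Hfree_x !linearZ /=; congr (_ *: _ + _ *: _ + _ *: _).
- rewrite raddf_sum; apply: eq_bigr => i _; rewrite /= -spin_act_linear.
  by apply: eq_spin_act => s'; rewrite /tfield tdx_restr.
- by rewrite -spin_act_linear.
rewrite tinvlap_dive_elec // sum_ord4 gamma_tm_sq // spin_act1 raddfD /= -tat_restr.
rewrite raddfB /=; congr (_ + _); rewrite [LHS]raddf_sum [X in - X]raddf_sum -sumrN.
apply: eq_bigr => i _ /=.
rewrite -2!spin_act_linear -spin_act_oppf; apply: eq_spin_act => s' /=.
by rewrite tinvlap_curl_magn // raddfN opprK /= tat_restr.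
Qed.

End SimultaneousFields.

(** * Assembly of the evolution equation and the constraints *)

Theorem mainTheorem7 (R : realType) (K : calculus R)
    (gamma : 'I_4 -> 'M[complex R]_4) (ex mx : R) (Psi : wave K) :
  dirac_matrices gamma ->
  wave_function Psi ->
  dirac_law gamma ex mx Psi ->
  maxwell_law gamma ex Psi ->
  coulomb_gauge Psi ->
  square_integrable Psi ->
  (forall (m n : nat) (s : {ffun 'I_m -> 'I_4}) (mu nu : {ffun 'I_n -> 'I_4}),
    'i *: tdt (tfield Psi m n s mu nu) =
      \sum_(j < m) Hfree_x gamma mx j (tfield Psi m n) s mu nu
      + \sum_(k < n) Hfree_y k (tfield Psi m n) s mu nu
      + Hint_absorb gamma ex (tfield Psi m n.+1) s mu nu
      + Hint_emit gamma ex (tfield Psi m n.-1) s mu nu)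
  /\
  (forall (m n : nat) (k : 'I_n) (s : {ffun 'I_m -> 'I_4})
      (mu nu : {ffun 'I_n -> 'I_4}),
    dive k (elec k (tfield Psi m n)) s mu nu =
      (ex / Num.sqrt n%:R)%:C *:
        \sum_(j < m)
          delta_term k j 1%:M (tfield Psi m n.-1) s mu nu
    /\
    dive k (magn k (tfield Psi m n)) s mu nu = 0).
Proof.
move=> gammaP _ dirac maxwell coulomb sqint; split=> [m n s mu nu|m n k s mu nu].
  rewrite [in LHS]/tfield tdt_restr raddfD /= scalerDr !(raddf_sum restr) /= !scaler_sumr.
  rewrite (eq_bigr _ (fun j _ =>
    electron_evolution j s mu nu gammaP dirac coulomb sqint)).
  rewrite [X in _ + X = _](eq_bigr _ (fun k _ =>
    photon_evolution k s mu nu maxwell)).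
  (* The sources come grouped by photon, whereas [Hint_emit] sums over electrons outermost. *)
  rewrite !big_split /= -!scaler_sumr [X in _ + (_ + _ *: X)]exchange_big.
  by rewrite addrACA [LHS]addrA.
by split; [apply: (gauss k s mu nu gammaP maxwell) | apply: dive_magn_tfield].
Qed.
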